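(* Let $n\ge 2$ be an integer, let $p,q,r\in\mathbb{R}$, and let $\phi\colon\mathbb{D}_{2n}\to\mathbb{R}$ be the function $$\phi(w)=\begin{cases}1&\text{if }w=e,\\ p&\text{if }w=s,\\ q&\text{if }w=t,\\ r&\text{otherwise.}\end{cases}$$ Then $\phi$ is positive definite on $\mathbb{D}_{2n}$ if and only if $$1+p+q+(2n-3)r\ge 0,\qquad 1-p-q+r\ge 0,$$ (plus $1+p-q-r\ge 0$ and $1-p+q-r\ge 0$ whenever $n$ is even) and $$\left|p-r+(q-r)e^{2\pi i a/n}\right|\le 1-r\qquad\text{for } a=1,2,\dots,\left\lfloor\tfrac{n-1}{2}\right\rfloor .$$
   Context: $\mathbb{D}_{2n}=\langle s,t\mid s^2=t^2=(st)^n=1\rangle$ is the dihedral group of order $2n$ with Coxeter generators $s,t$. A function $\varphi\colon\Gamma\to\mathbb{C}$ on a group $\Gamma$ is positive definite if $\sum_{x,y\in\Gamma}\varphi(y^{-1}x)\alpha(x)\overline{\alpha(y)}\ge 0$ for every finitely supported $\alpha\colon\Gamma\to\mathbb{C}$. *)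

(* Defs.v *)
From HB Require Import structures.
From mathcomp Require Import all_boot all_order all_algebra all_fingroup.
From mathcomp Require Import all_solvable finmap complex.
From mathcomp Require Import reals trigo.

Set Implicit Arguments.
Unset Strict Implicit.
Unset Printing Implicit Defensive.

Import Order.TTheory GRing.Theory Num.Theory.

Local Open Scope ring_scope.
Local Open Scope complex_scope.

(* In R[i], 0 <= z means that z is real and nonnegative. *)
Definition positive_definite (R : rcfType) (G : groupType) (f : G -> R[i]) :
    Prop :=
  forall a : {fsfun G -> R[i] with 0},
    0 <= \sum_(x <- finsupp a) \sum_(y <- finsupp a)
           f (y^-1 * x)%g * a x * (a y)^*.

(* gT is the group < s, t | s^2 = t^2 = (st)^n = 1 >.  "\isog Grp" does not
   name the generators, so those of the isomorphism are fixed separately: s and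
   t generate gT and satisfy the relations, hence the surjection from the
   presented (finite) group of the same order is an isomorphism. *)
Definition dihedral_coxeter_generators (n : nat) (gT : finGroupType)
    (s t : gT) : Prop :=
  [/\ ([set: gT] \isog Grp (x : y : x ^+ 2, y ^+ 2, (x * y) ^+ n))%g,
      (<<[set s; t]>> = [set: gT])%g,
      (s ^+ 2 = 1)%g, (t ^+ 2 = 1)%g & ((s * t) ^+ n = 1)%g].

Lemma dihedral_coxeter_generators_exist (n : nat) : (1 < n)%N ->
  exists s t : 'D_(n.*2), dihedral_coxeter_generators n s t.
Proof.
move=> n_gt1; have isoD := Grp'_dihedral n_gt1.
have /existsP[[s t] /eqP[genD s2 t2 stn]] := isoGrp_hom isoD.
by exists s, t; split=> //; rewrite -genD joing_idl joing_idr.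
Qed.

Definition dihedral_function (R : realType) (gT : finGroupType) (s t : gT)
    (p q r : R) (w : gT) : R :=
  if w == 1%g then 1 else if w == s then p else if w == t then q else r.

(* e^(i * theta) *)
Definition cexpi (R : realType) (theta : R) : R[i] :=
  cos theta +i* sin theta.

(* Main.v *)
Require Import Defs.
From HB Require Import structures.
From mathcomp Require Import all_boot all_order all_algebra all_fingroup.
From mathcomp Require Import all_solvable finmap complex.
From mathcomp Require Import reals trigo.
From mathcomp Require Import ring lra zify.

Set Implicit Arguments.
Unset Strict Implicit.
Unset Printing Implicit Defensive.

Import Order.TTheory GRing.Theory Num.Theory.

Local Open Scope ring_scope.

(** Put c = s t, an element of order n.  Positive definiteness of a function
    phi on a finite group says that the sesquilinear form hform phi is
    nonnegative, and this form is invariant under left translations.  Under the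
    left translations by the powers of c, every function f splits into its
    components f_z, for z^n = 1, with f_z (c g) = z f_z g, and by the Parseval
    identity the value of the form at f is a positive multiple of the sum of
    its values at the components (hform_equivariant_parts).  Hence it suffices
    to test the form on z-equivariant functions, one n-th root of unity z at a
    time.

    In the dihedral group every element is c^k or c^k s for a unique k < n, so
    a z-equivariant function h is determined by A = h 1 and B = h s, which are
    arbitrary.  Since t = c^-1 s, right translation by s exchanges A and B,
    and right translation by t exchanges them up to the factors z and z^-1.
    On such an h the form is therefore n times a Hermitian form in (A, B), with
    diagonal entries d = 1 - r + r e and off-diagonal entry
    p - r + (q - r) z + r e, where e, the sum of the powers of z, is n if z = 1
    and 0 otherwise (hform_coxeter_function).  A Hermitian 2x2 matrix
    with equal diagonal entries d and off-diagonal entry v is nonnegative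
    exactly when |v| <= d (hermitian2_ge0P).

    What remains is to read off these inequalities for z = w^a, a < n, with
    w = e^(2 pi i / n) (dihedral_blocks): a = 0 gives the first two conditions
    of the theorem, a = n / 2, where z = -1, gives the pair for even n, and
    a and n - a give the same condition because their roots are conjugate. *)

(** * Sums over roots of unity *)

Lemma unity_root_neq0 (K : nzRingType) (n : nat) (z : K) :
  (0 < n)%N -> z ^+ n = 1 -> z != 0.
Proof.
move=> n_gt0; apply: contra_eq_neq => ->.
by rewrite expr0n gtn_eqF // eq_sym oner_eq0.
Qed.

Lemma unity_root_conj (C : numClosedFieldType) (n : nat) (z : C) :
  (0 < n)%N -> z ^+ n = 1 -> z^* = z^-1.
Proof.
move=> n_gt0 zn1; rewrite invC_norm.
suff -> : `|z| = 1 by rewrite expr1n invr1 mul1r.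
by apply/eqP; rewrite -(@pexpr_eq1 _ `|z| n) // -normrX zn1 normr1.
Qed.

Lemma sum_unity_root_expr (F : fieldType) (n : nat) (z : F) :
  z ^+ n = 1 -> \sum_(k < n) z ^+ k = if z == 1 then n%:R else 0.
Proof.
case: eqP => [-> _|/eqP z_neq1 zn1].
  by under eq_bigr do rewrite expr1n; rewrite sumr_const card_ord.
have := subrX1 z n; rewrite zn1 subrr => /esym/eqP.
by rewrite mulf_eq0 subr_eq0 (negPf z_neq1) /= => /eqP.
Qed.

(** Only k = l survives in the double sum: the sum over a of (w^(l-k))^a
    vanishes unless w^(l-k) = 1. *)
Lemma dft_parseval (C : numClosedFieldType) (n : nat) (w : C)
    (u v : 'I_n -> C) :
  n.-primitive_root w ->
  \sum_(a < n) (\sum_(k < n) (w ^+ a) ^- k * u k)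
               * (\sum_(k < n) (w ^+ a) ^- k * v k)^*
  = n%:R * \sum_(k < n) u k * (v k)^*.
Proof.
move=> w_prim; have n_gt0 := prim_order_gt0 w_prim.
have wn1 := prim_expr_order w_prim.
have w_neq0 := unity_root_neq0 n_gt0 wn1.
have expand (a : 'I_n) :
    (\sum_(k < n) (w ^+ a) ^- k * u k)
    * (\sum_(k < n) (w ^+ a) ^- k * v k)^*
  = \sum_(k < n) \sum_(l < n) u k * (v l)^* * (w ^+ l / w ^+ k) ^+ a.
  rewrite rmorph_sum mulr_suml; apply: eq_bigr => k _.
  rewrite mulr_sumr; apply: eq_bigr => l _.
  rewrite rmorphM fmorphV !rmorphXn /= (unity_root_conj n_gt0 wn1).
  rewrite !exprVn invrK expr_div_n -!exprM mulnC (mulnC l).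
  by rewrite mulrACA mulrC (mulrC (w ^+ _)^-1).
rewrite (eq_bigr _ (fun a _ => expand a)) exchange_big mulr_sumr /=.
apply: eq_bigr => k _; rewrite exchange_big /= (bigD1 k) //= [X in _ + X]big1.
  rewrite addr0 -mulr_sumr divff ?expf_neq0 // mulrC; congr (_ * _).
  by under eq_bigr do rewrite expr1n; rewrite sumr_const card_ord.
move=> l l_neq_k; rewrite -mulr_sumr sum_unity_root_expr; last first.
  by rewrite expr_div_n -!exprM mulnC (mulnC k) !exprM wn1 !expr1n divr1.
rewrite ifN ?mulr0 //; apply: contra l_neq_k => /eqP /divr1_eq /eqP.
by rewrite (eq_prim_root_expr w_prim) !modn_small.
Qed.

(** * Hermitian forms in two variables *)

(** The off-diagonal part is 2 Re (z A conj(B)), which is at least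
    - 2 |z| |A| |B|, and this bound is attained with |A| = |B|. *)
Lemma hermitian2_ge0P (C : numClosedFieldType) (d z : C) : d \is Num.real ->
  (forall A B : C,
     0 <= (d * (A * A^* + B * B^*) + (z^* * (B * A^*) + z * (A * B^*))))
  <-> `|z| <= d.
Proof.
move=> d_real; split=> [pos|z_le_d A B].
  have [z0|z_neq0] := eqVneq z 0.
    have := pos 1 0.
    by rewrite z0 normr0 conjC0 conjC1 !(mul0r, mulr0, addr0, mulr1).
  (* This choice makes z A B^* equal to - |z|^3, as negative as possible. *)
  have := pos (- z^*) `|z|.
  rewrite rmorphN /= conjCK (CrealP (normr_real z)).
  have -> : (d * (- z^* * - z + `|z| * `|z|)
             + (z^* * (`|z| * - z) + z * (- z^* * `|z|)))
            = (2 * `|z| ^+ 2) * (d - `|z|).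
    have := normCK z; move: (`|z|) (z^*) => m zc m2.
    transitivity (d * (z * zc + m ^+ 2) - 2 * m * (z * zc)); first by ring.
    by rewrite -m2; ring.
  by rewrite pmulr_rge0 ?subr_ge0 // mulr_gt0 // exprn_gt0 // normr_gt0.
have d_ge0 : 0 <= d := le_trans (normr_ge0 z) z_le_d.
have [d0|d_neq0] := eqVneq d 0.
  move: z_le_d; rewrite d0 normr_le0 => /eqP ->.
  by rewrite conjC0 !mul0r !addr0.
have d_gt0 : 0 < d by rewrite lt_def d_neq0.
(* Completing the square after multiplication by d. *)
rewrite -(pmulr_rge0 _ d_gt0).
set E := (X in 0 <= d * X).
have -> : d * E = `|d * A + z^* * B| ^+ 2 + (d ^+ 2 - `|z| ^+ 2) * `|B| ^+ 2.
  rewrite !normCK rmorphD !rmorphM /= conjCK (CrealP d_real) /E; ring.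
rewrite addr_ge0 ?exprn_ge0 // mulr_ge0 ?exprn_ge0 // subr_ge0.
by rewrite lerXn2r ?nnegrE.
Qed.

(** * Invariant forms and equivariant functions *)

Definition hform (C : numClosedFieldType) (gT : finGroupType)
    (phi f : gT -> C) : C :=
  \sum_x \sum_y phi (y^-1 * x)%g * f x * (f y)^*.

Definition equivariant (C : numClosedFieldType) (gT : finGroupType)
    (c : gT) (z : C) (h : gT -> C) : Prop :=
  forall g, h (c * g)%g = z * h g.

(** This is n times the projection of f to the z-equivariant functions; leaving
    out the factor 1/n keeps divisions away. *)
Definition equivariant_part (C : numClosedFieldType) (gT : finGroupType)
    (n : nat) (c : gT) (z : C) (f : gT -> C) (g : gT) : C :=
  \sum_(k < n) z ^- k * f (c ^+ k * g)%g.

Lemma equivariant_partP (C : numClosedFieldType) (gT : finGroupType)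
    (n : nat) (c : gT) (z : C) (f : gT -> C) :
  (0 < n)%N -> (c ^+ n = 1)%g -> z ^+ n = 1 ->
  equivariant c z (equivariant_part n c z f).
Proof.
case: n => // n n_gt0 cn1 zn1 g; rewrite /equivariant_part mulr_sumr.
have z_neq0 := unity_root_neq0 n_gt0 zn1.
rewrite big_ord_recr [RHS]big_ord_recl /= addrC; congr (_ + _).
  rewrite mulgA -expgSr cn1 !mul1g expr0 invr1 mul1r.
  congr (_ * _); apply: (mulIf (expf_neq0 n z_neq0)).
  by rewrite mulVf ?expf_neq0 // -exprS zn1.
apply: eq_bigr => k _; rewrite mulgA -expgSr mulrA; congr (_ * _).
by rewrite /bump /= add1n exprS invfM mulVKf.
Qed.

Lemma equivariantX (C : numClosedFieldType) (gT : finGroupType)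
    (c : gT) (z : C) (h : gT -> C) (k : nat) (g : gT) :
  equivariant c z h -> h (c ^+ k * g)%g = z ^+ k * h g.
Proof.
move=> hE; elim: k => [|k IHk]; first by rewrite mul1g mul1r.
by rewrite expgS -mulgA hE IHk mulrA -exprS.
Qed.

(** Parseval along the powers of c turns the left side into n times the sum of
    the values of the form at the n translates of f by powers of c, and these
    values are all equal because y^-1 x does not change when x and y are both
    translated on the left. *)
Lemma hform_equivariant_parts (C : numClosedFieldType) (gT : finGroupType)
    (n : nat) (c : gT) (w : C) (phi f : gT -> C) :
  n.-primitive_root w ->
  \sum_(a < n) hform phi (equivariant_part n c (w ^+ a) f)
  = n%:R ^+ 2 * hform phi f.
Proof.
move=> w_prim; rewrite /hform exchange_big /=.
under eq_bigr do rewrite exchange_big /=.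
have swap x y :
  \sum_(a < n) phi (y^-1 * x)%g * equivariant_part n c (w ^+ a) f x
                 * (equivariant_part n c (w ^+ a) f y)^*
  = n%:R * \sum_(k < n) phi (y^-1 * x)%g * f (c ^+ k * x)%g
                         * (f (c ^+ k * y)%g)^*.
  under eq_bigr do rewrite -mulrA.
  rewrite -mulr_sumr /equivariant_part.
  rewrite (dft_parseval (fun k : 'I_n => f (c ^+ k * x)%g)
             (fun k : 'I_n => f (c ^+ k * y)%g) w_prim).
  by rewrite mulrCA mulr_sumr; under eq_bigr do rewrite mulrA.
under eq_bigr do under eq_bigr do rewrite swap.
under eq_bigr do rewrite -mulr_sumr exchange_big /=.
rewrite -mulr_sumr exchange_big /= expr2 -mulrA; congr (_ * _).
transitivity (\sum_(k < n)
    \sum_x \sum_y phi (y^-1 * x)%g * f x * (f y)^*); last first.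
  by rewrite sumr_const card_ord mulr_natl.
apply: eq_bigr => k _.
rewrite [RHS](reindex_inj (mulgI (c ^+ k)%g)); apply: eq_bigr => x _.
rewrite [RHS](reindex_inj (mulgI (c ^+ k)%g)); apply: eq_bigr => y _.
by rewrite invMg mulgA mulgKV.
Qed.

Lemma hform_ge0_equivariant (C : numClosedFieldType) (gT : finGroupType)
    (n : nat) (c : gT) (w : C) (phi : gT -> C) :
  n.-primitive_root w -> (c ^+ n = 1)%g ->
  (forall f, 0 <= hform phi f) <->
  (forall (a : 'I_n) h, equivariant c (w ^+ a) h -> 0 <= hform phi h).
Proof.
move=> w_prim cn1; have n_gt0 := prim_order_gt0 w_prim.
split=> [pos a h _|pos f]; first exact: pos.
have n2_gt0 : 0 < n%:R ^+ 2 :> C by rewrite exprn_gt0 // ltr0n.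
rewrite -(pmulr_rge0 _ n2_gt0) -(hform_equivariant_parts c _ _ w_prim).
apply: sumr_ge0 => a _; apply: (pos a); apply: equivariant_partP => //.
by rewrite -exprM mulnC exprM (prim_expr_order w_prim) expr1n.
Qed.

(** Writing x = y g makes the right translates of f appear; the inner sum is
    then explicit as soon as phi is constant outside a few elements. *)
Lemma hformE (C : numClosedFieldType) (gT : finGroupType) (phi f : gT -> C) :
  hform phi f = \sum_y (\sum_g phi g * f (y * g)%g) * (f y)^*.
Proof.
rewrite /hform exchange_big; apply: eq_bigr => y _ /=.
rewrite (reindex_inj (mulgI y)) mulr_suml; apply: eq_bigr => g _.
by rewrite mulKg.
Qed.

(** * Normal form in the dihedral group *)

(** Each of the two groups with the given presentation, gT and 'D_(2n), is a
    quotient of the other. *)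
Lemma card_dihedral_coxeter (n : nat) (gT : finGroupType) (s t : gT) :
  (2 <= n)%N -> dihedral_coxeter_generators n s t -> #|gT| = (2 * n)%N.
Proof.
move=> n_ge2 [isoG _ _ _ _].
have homGD : ([set: gT] \homg [set: 'D_(n.*2)])%g.
  by rewrite (Grp'_dihedral n_ge2) (isoGrp_hom (G := [group of setT]) isoG).
have homDG : ([set: 'D_(n.*2)] \homg [set: gT])%g.
  by rewrite isoG (isoGrp_hom (Grp'_dihedral n_ge2)).
apply/eqP; rewrite -cardsT mul2n -(card_dihedral n_ge2) eqn_leq.
by rewrite (leq_homg homGD) (leq_homg homDG).
Qed.

(** Surjectivity holds because s inverts s t, so that <[s * t]> * <[s]> is a
    subgroup; it contains both generators.  Injectivity then follows by
    counting. *)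
Lemma dihedral_normal_form (n : nat) (gT : finGroupType) (s t : gT) :
  (2 <= n)%N -> dihedral_coxeter_generators n s t ->
  bijective (fun kb : 'I_n * bool => ((s * t) ^+ kb.1 * s ^+ kb.2)%g).
Proof.
move=> n_ge2 hst; have cardG := card_dihedral_coxeter n_ge2 hst.
have [_ genG s2 t2 stn] := hst.
have sV : (s^-1 = s)%g by apply/eqP; rewrite eq_invg_mul; apply/eqP; exact: s2.
have tV : (t^-1 = t)%g by apply/eqP; rewrite eq_invg_mul; apply/eqP; exact: t2.
set f := fun kb => _.
have sub : (#|gT| <= #|codom f|)%N.
  apply: subset_leq_card; apply/subsetP => x _.
  have nC : <[s]>%g \subset 'N(<[s * t]>)%g.
    rewrite cycle_subG; apply/normP; rewrite -cycleJ -[RHS]cycleV.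
    by congr <[_]>%g; rewrite /conjg -mulgA mulKg invMg sV tV.
  have : x \in (<[s * t]> * <[s]>)%g.
    rewrite -(norm_joinEr nC); apply: (subsetP _ x (in_setT x)).
    rewrite -genG gen_subG; apply/subsetP => y /set2P y_st.
    have s_in : s \in (<[s * t]> <*> <[s]>)%g.
      by rewrite (subsetP (joing_subr _ _)) ?cycle_id.
    have st_in : (s * t)%g \in (<[s * t]> <*> <[s]>)%g.
      by rewrite (subsetP (joing_subl _ _)) ?cycle_id.
    case: y_st => -> //.
    by have := groupM (groupVr s_in) st_in; rewrite mulKg.
  case/mulsgP=> _ _ /cycleP[i ->] /cycleP[j ->] ->.
  have i_lt : (i %% n < n)%N by rewrite ltn_mod; lia.
  apply/codomP; exists (Ordinal i_lt, odd j); rewrite /f /=.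
  rewrite expg_mod //; congr (_ * _)%g.
  by rewrite -[in LHS](odd_double_half j) -mul2n expgD expgM s2 expg1n mulg1.
have cardT : #|{: 'I_n * bool}| = (2 * n)%N.
  by rewrite card_prod card_ord card_bool mulnC.
apply: inj_card_bij; last by rewrite cardT cardG.
have /image_injP f_inj : #|codom f| == #|{: 'I_n * bool}|.
  by rewrite eqn_leq leq_image_card cardT -cardG sub.
by move=> x y; apply: f_inj.
Qed.

Lemma dihedral_equivariant_sum (C : numClosedFieldType) (n : nat)
    (gT : finGroupType) (s t : gT) (z : C) (h : gT -> C) :
  (2 <= n)%N -> dihedral_coxeter_generators n s t ->
  equivariant (s * t)%g z h ->
  \sum_g h g = (\sum_(k < n) z ^+ k) * (h 1%g + h s).
Proof.
move=> n_ge2 hst hE.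
rewrite (reindex _ (onW_bij _ (dihedral_normal_form n_ge2 hst))) /=.
rewrite -(pair_bigA _ (fun (k : 'I_n) (b : bool) =>
                         h ((s * t) ^+ k * s ^+ b)%g)) /=.
rewrite mulr_suml; apply: eq_bigr => k _.
by rewrite big_bool /= expg1 expg0 !(equivariantX _ _ hE) -mulrDr addrC.
Qed.

Lemma eq_dihedral_normal_form (n : nat) (gT : finGroupType) (s t : gT)
    (i j : nat) (b b' : bool) :
  (2 <= n)%N -> dihedral_coxeter_generators n s t -> (i < n)%N -> (j < n)%N ->
  ((s * t) ^+ i * s ^+ b == (s * t) ^+ j * s ^+ b')%g = (i == j) && (b == b').
Proof.
move=> n_ge2 hst i_lt j_lt.
have f_inj := bij_inj (dihedral_normal_form n_ge2 hst).
exact: (inj_eq f_inj (Ordinal i_lt, b) (Ordinal j_lt, b')).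
Qed.

(** The normal forms of 1, s and t are those with (k, b) equal to (0, 0), (0, 1)
    and (n - 1, 1). *)
Lemma dihedral_neq (n : nat) (gT : finGroupType) (s t : gT) :
  (2 <= n)%N -> dihedral_coxeter_generators n s t ->
  [/\ s != 1, t != 1 & t != s]%g.
Proof.
move=> n_ge2 hst; have nfE := eq_dihedral_normal_form _ _ n_ge2 hst.
have [_ _ s2 t2 stn] := hst.
have n_gt0 : (0 < n)%N by lia.
have tE : ((s * t) ^+ n.-1 * s ^+ true = t)%g.
  apply: (mulgI (s * t)%g); rewrite mulgA -expgS prednK // stn mul1g -mulgA.
  by rewrite -[(t * t)%g]/(t ^+ 2)%g t2 mulg1.
have n1_lt : (n.-1 < n)%N by rewrite prednK.
have s1E : ((s * t) ^+ 0 * s ^+ true = s)%g by rewrite mul1g.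
have e1E : ((s * t) ^+ 0 * s ^+ false = 1)%g by rewrite mul1g.
split.
- by have := nfE 0 0 true false n_gt0 n_gt0; rewrite s1E e1E => ->.
- by have := nfE _ 0 true false n1_lt n_gt0; rewrite tE e1E andbF => ->.
- have := nfE _ 0 true true n1_lt n_gt0; rewrite tE s1E andbT => ->.
  lia.
Qed.

(** * The form of the dihedral function *)

(** Take the z-equivariant part of the function supported on {1, s} with values
    A and B: since 1 and s lie in different cosets of <[s * t]>, no other
    translate contributes to its values at 1 and s. *)
Lemma dihedral_equivariant_exists (C : numClosedFieldType) (n : nat)
    (gT : finGroupType) (s t : gT) (z A B : C) :
  (2 <= n)%N -> dihedral_coxeter_generators n s t -> z ^+ n = 1 ->
  exists h : gT -> C, [/\ equivariant (s * t)%g z h, h 1%g = A & h s = B].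
Proof.
move=> n_ge2 hst zn1; have n_gt0 : (0 < n)%N by lia.
have [_ _ _ _ stn] := hst; have [s_neq1 _ _] := dihedral_neq n_ge2 hst.
have nfE (k : 'I_n) (b b' : bool) :
    ((s * t) ^+ k * s ^+ b == s ^+ b')%g = (k == 0 :> nat) && (b == b').
  rewrite -(eq_dihedral_normal_form b b' n_ge2 hst (ltn_ord k) n_gt0).
  by rewrite expg0 mul1g.
pose f (x : gT) := if x == 1%g then A else if x == s then B else 0.
exists (equivariant_part n (s * t)%g z f).
have valE (b : bool) :
    equivariant_part n (s * t)%g z f (s ^+ b)%g = f (s ^+ b)%g.
  rewrite /equivariant_part (bigD1 (Ordinal n_gt0)) //= invr1 mul1g mul1r.
  rewrite big1 ?addr0 // => k k_neq0.
  have := nfE k b false; have := nfE k b true.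
  rewrite expg0 expg1 (negPf (k_neq0 : k != 0 :> nat)) /= => kb_s kb_1.
  by rewrite /f kb_s kb_1 mulr0.
split; first exact: equivariant_partP.
- by have := valE false; rewrite /= expg0 /f eqxx.
- by have := valE true; rewrite /= expg1 /f (negPf s_neq1) eqxx.
Qed.

(** The function of the theorem over an arbitrary ring, so that its parameters
    can be complex. *)
Definition coxeter_function (K : nzRingType) (gT : finGroupType) (s t : gT)
    (p q r : K) (w : gT) : K :=
  if w == 1%g then 1 else if w == s then p else if w == t then q else r.

(** The function is the constant r corrected at the three points 1, s and t. *)
Lemma sum_coxeter_function (K : nzRingType) (gT : finGroupType)
    (s t : gT) (p q r : K) (u : gT -> K) :
  s != 1%g -> t != 1%g -> t != s ->
  \sum_g coxeter_function s t p q r g * u g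
  = r * (\sum_g u g) + (1 - r) * u 1%g + (p - r) * u s + (q - r) * u t.
Proof.
move=> s_neq1 t_neq1 t_neqs; rewrite mulr_sumr.
have pick (x : gT) (k : K) :
    k * u x = \sum_g if g == x then k * u g else 0.
  by rewrite -big_mkcond big_pred1_eq.
rewrite (pick 1%g) (pick s) (pick t) -!big_split; apply: eq_bigr => g _ /=.
rewrite /coxeter_function.
have [->|g_neq1] := eqVneq g 1%g.
  rewrite eq_sym (negPf s_neq1) eq_sym (negPf t_neq1) !addr0.
  by rewrite -mulrDl addrC subrK.
have [->|g_neqs] := eqVneq g s.
  by rewrite eq_sym (negPf t_neqs) !addr0 -mulrDl addrC subrK.
by case: eqP => _; rewrite !addr0 // -mulrDl addrC subrK.
Qed.

(** The summand y of hformE is invariant under y |-> c y, so the sum over the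
    group is n times the contribution of y = 1 and y = s. *)
Lemma hform_coxeter_function (C : numClosedFieldType) (n : nat)
    (gT : finGroupType) (s t : gT) (p q r z : C) (h : gT -> C) :
  (2 <= n)%N -> dihedral_coxeter_generators n s t -> z ^+ n = 1 ->
  equivariant (s * t)%g z h ->
  let e := \sum_(k < n) z ^+ k in
  hform (coxeter_function s t p q r) h
  = n%:R * ((1 - r + r * e) * (h 1%g * (h 1%g)^* + h s * (h s)^*)
            + ((p - r + (q - r) * z^-1 + r * e) * (h s * (h 1%g)^*)
               + (p - r + (q - r) * z + r * e) * (h 1%g * (h s)^*))).
Proof.
move=> n_ge2 hst zn1 hE e.
have [_ _ s2 t2 _] := hst.
have [s_neq1 t_neq1 t_neqs] := dihedral_neq n_ge2 hst.
have n_gt0 : (0 < n)%N by lia.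
have z_neq0 := unity_root_neq0 n_gt0 zn1.
rewrite hformE (dihedral_equivariant_sum (z := 1) n_ge2 hst); last first.
  move=> y; rewrite mul1r hE rmorphM /= (unity_root_conj n_gt0 zn1).
  under eq_bigr do rewrite -mulgA hE mulrCA.
  by rewrite -mulr_sumr mulrACA divff ?mul1r.
under eq_bigr do rewrite expr1n.
rewrite sumr_const card_ord; congr (_ * _).
have sumh y : \sum_g h (y * g)%g = e * (h 1%g + h s).
  rewrite -(dihedral_equivariant_sum n_ge2 hst hE).
  by rewrite [RHS](reindex_inj (mulgI y)).
(* (s t) t = s, so h s = z (h t). *)
have htE : h t = z^-1 * h s.
  apply: (mulfI z_neq0); rewrite mulVKf // -hE -mulgA.
  by rewrite -[(t * t)%g]/(t ^+ 2)%g t2 mulg1.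
have hstE : h (s * t)%g = z * h 1%g by rewrite -[(s * t)%g]mulg1 hE.
have hssE : h (s * s)%g = h 1%g by rewrite -[(s * s)%g]/(s ^+ 2)%g s2.
rewrite !sum_coxeter_function // !sumh !mul1g !mulg1 htE hstE hssE.
ring.
Qed.

Lemma hform_coxeter_function_ge0 (C : numClosedFieldType) (n : nat)
    (gT : finGroupType) (s t : gT) (w p q r : C) :
  (2 <= n)%N -> dihedral_coxeter_generators n s t -> n.-primitive_root w ->
  p \is Num.real -> q \is Num.real -> r \is Num.real ->
  (forall f, 0 <= hform (coxeter_function s t p q r) f) <->
  (forall a : 'I_n, let e := if a == 0 :> nat then n%:R else 0 in
     `|p - r + (q - r) * w ^+ a + r * e| <= 1 - r + r * e).
Proof.
move=> n_ge2 hst w_prim p_real q_real r_real; have [_ _ _ _ stn] := hst.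
rewrite (hform_ge0_equivariant _ w_prim stn).
have n_gt0 : 0 < n%:R :> C by rewrite ltr0n; lia.
have blockP (a : 'I_n) :
    let e := if a == 0 :> nat then n%:R else 0 in
    (forall h, equivariant (s * t)%g (w ^+ a) h ->
       0 <= hform (coxeter_function s t p q r) h)
    <-> `|p - r + (q - r) * w ^+ a + r * e| <= 1 - r + r * e.
  move=> e; set z := w ^+ a.
  have zn1 : z ^+ n = 1.
    by rewrite /z -exprM mulnC exprM (prim_expr_order w_prim) expr1n.
  have sumE : \sum_(k < n) z ^+ k = e.
    rewrite sum_unity_root_expr // /z -(prim_order_dvd w_prim) /e.
    case: (nat_of_ord a) (ltn_ord a) => [|m] m_lt; first by rewrite dvdn0.
    by rewrite gtnNdvd.
  have e_real : e \is Num.real by rewrite /e; case: ifP.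
  have d_real : 1 - r + r * e \is Num.real by rewrite realD ?realB ?realM.
  rewrite -(hermitian2_ge0P _ d_real).
  have conjE : (p - r + (q - r) * z + r * e)^*
             = p - r + (q - r) * z^-1 + r * e.
    rewrite !(rmorphD, rmorphN, rmorphM) /=.
    rewrite (unity_root_conj _ zn1); last by lia.
    by rewrite (CrealP p_real) (CrealP q_real) (CrealP r_real) (CrealP e_real).
  rewrite conjE; split=> [pos A B|pos h hE].
    have [h [hE <- <-]] := dihedral_equivariant_exists A B n_ge2 hst zn1.
    by have := pos h hE; rewrite (hform_coxeter_function _ _ _ n_ge2 hst zn1) //
      sumE pmulr_rge0.
  rewrite (hform_coxeter_function _ _ _ n_ge2 hst zn1) //.
  by rewrite sumE pmulr_rge0.
by split=> H a; [apply/blockP => h; apply: H | move=> h; move: h; apply/blockP].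
Qed.

(** * Complex exponentials and the final inequalities *)

Local Open Scope complex_scope.

Lemma positive_definiteE (R : rcfType) (gT : finGroupType)
    (phi : gT -> R[i]) :
  positive_definite phi <-> (forall f, 0 <= hform phi f).
Proof.
have sumE (a : {fsfun gT -> R[i] with 0}) :
    \sum_(x <- finsupp a) \sum_(y <- finsupp a)
      phi (y^-1 * x)%g * a x * ((a y)^*)%R = hform phi a.
  have out x : x \notin finsupp a -> a x = 0 by exact: fsfun_dflt.
  rewrite /hform big_uniq ?fset_uniq // big_mkcond; apply: eq_bigr => x _.
  case: ifPn => [_|/out ax0].
    rewrite big_uniq ?fset_uniq // big_mkcond; apply: eq_bigr => y _.
    by case: ifPn => // /out ay0; rewrite ay0 conjC0 mulr0.
  by rewrite big1 // => y _; rewrite ax0 mulr0 mul0r.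
split=> [pos f|pos a]; last by rewrite sumE.
have := pos [fsfun x in [fset x | x in enum gT]%fset => f x].
rewrite sumE; congr (0 <= _).
apply: eq_bigr => x _; apply: eq_bigr => y _.
by rewrite !fsfunE !inE !mem_enum.
Qed.

Lemma cexpiD (R : realType) (x y : R) : cexpi (x + y) = cexpi x * cexpi y.
Proof.
rewrite /cexpi cosD sinD; apply/eqP; rewrite eq_complex /= eqxx /=.
by rewrite addrC.
Qed.

Lemma cexpiX (R : realType) (x : R) (k : nat) :
  cexpi x ^+ k = cexpi (x * k%:R).
Proof.
elim: k => [|k IHk]; first by rewrite mulr0 /cexpi cos0 sin0.
by rewrite exprS IHk -cexpiD -natr1 mulrDr mulr1 addrC.
Qed.

Lemma cexpi_neq1 (R : realType) (x : R) : 0 < x < 2 * pi -> cexpi x != 1.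
Proof.
move=> /andP[x_gt0 x_lt]; rewrite eq_complex /= negb_and; apply/orP; left.
have -> : x = (x / 2) *+ 2 by lra.
have sin_gt0 : 0 < sin (x / 2) by apply: sin_gt0_pi; lra.
rewrite cos_mulr2n cos2sin2 lt_eqF //.
have := exprn_gt0 2 sin_gt0; lra.
Qed.

Lemma cexpi_primitive_root (R : realType) (n : nat) :
  (0 < n)%N -> n.-primitive_root (cexpi (2 * pi / n%:R) : R[i]).
Proof.
move=> n_gt0; have n0 : 0 < n%:R :> R by rewrite ltr0n.
have wn1 : cexpi (2 * pi / n%:R) ^+ n = 1 :> R[i].
  by rewrite cexpiX divfK ?gt_eqF // mulr_natl /cexpi cos2pi sin2pi.
rewrite /primitive_root_of_unity n_gt0; apply/forallP => i; apply/eqP.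
rewrite unity_rootE.
have [->|i_neq] := eqVneq i.+1 n; first by rewrite wn1 eqxx.
apply/negbTE; rewrite cexpiX; apply: cexpi_neq1.
have i_lt : (i.+1 < n)%N by rewrite ltn_neqAle i_neq ltn_ord.
have pi0 := pi_gt0 R.
rewrite mulr_gt0 ?divr_gt0 ?mulr_gt0 ?ltr0n //=.
by rewrite mulrAC ltr_pdivrMr // ltr_pM2l ?mulr_gt0 // ltr_nat.
Qed.

Lemma complex_ler_norml (R : rcfType) (x d : R) :
  (`|x%:C| <= d%:C) = (- d <= x <= d).
Proof. by rewrite normc_def /= expr0n addr0 sqrtr_sqr lecR ler_norml. Qed.

(** The two numbers are complex conjugates. *)
Lemma norm_prim_root_affine (C : numClosedFieldType) (n a : nat) (w u v : C) :
  n.-primitive_root w -> u \is Num.real -> v \is Num.real -> (a <= n)%N ->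
  `|u + v * w ^+ (n - a)| = `|u + v * w ^+ a|.
Proof.
move=> w_prim u_real v_real a_le; have n_gt0 := prim_order_gt0 w_prim.
have wn1 := prim_expr_order w_prim.
rewrite -[RHS]norm_conjC rmorphD rmorphM rmorphXn /= (CrealP u_real).
rewrite (CrealP v_real) (unity_root_conj n_gt0 wn1) expfB_cond ?wn1.
  by rewrite mul1r exprVn.
by rewrite (negPf (unity_root_neq0 n_gt0 wn1)).
Qed.

(** The n block conditions are folded by the symmetry a |-> n - a, which fixes
    only a = 0 and, for even n, a = n / 2; there the off-diagonal entry is
    real and the condition is a pair of linear inequalities. *)
Lemma dihedral_blocks (R : rcfType) (n : nat) (w : R[i]) (p q r : R) :
  (2 <= n)%N -> n.-primitive_root w ->
  (forall a : 'I_n, let e := if a == 0 :> nat then n%:R else 0 in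
     `|p%:C - r%:C + (q%:C - r%:C) * w ^+ a + r%:C * e|
       <= 1 - r%:C + r%:C * e) <->
  [/\ 0 <= 1 + p + q + (2 * n - 3)%N%:R * r,
      0 <= 1 - p - q + r,
      ~~ odd n -> 0 <= 1 + p - q - r /\ 0 <= 1 - p + q - r
    & forall a : nat, (1 <= a <= (n - 1) %/ 2)%N ->
        `|(p - r)%:C + (q - r)%:C * w ^+ a| <= (1 - r)%:C].
Proof.
move=> n_ge2 w_prim; have n_gt0 : (0 < n)%N by lia.
have wn1 := prim_expr_order w_prim.
pose K a := `|(p - r)%:C + (q - r)%:C * w ^+ a| <= (1 - r)%:C.
have trivial_block : (`|p%:C - r%:C + (q%:C - r%:C) * w ^+ 0 + r%:C * n%:R|
       <= 1 - r%:C + r%:C * n%:R) =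
    (0 <= 1 + p + q + (2 * n - 3)%N%:R * r) && (0 <= 1 - p - q + r).
  have -> : p%:C - r%:C + (q%:C - r%:C) * w ^+ 0 + r%:C * n%:R
            = (p - r + (q - r) + r * n%:R)%:C.
    by rewrite expr0 mulr1 !(rmorphD, rmorphN, rmorphM) /= rmorph_nat.
  have -> : 1 - r%:C + r%:C * n%:R = (1 - r + r * n%:R)%:C.
    by rewrite !(rmorphD, rmorphN, rmorphM) /= rmorph_nat.
  rewrite complex_ler_norml natrB; last by lia.
  by rewrite natrM; congr (_ && _); apply/idP/idP; lra.
have block a :
    (`|p%:C - r%:C + (q%:C - r%:C) * w ^+ a + r%:C * 0| <= 1 - r%:C + r%:C * 0)
    = K a.
  by rewrite mulr0 !addr0 /K !(rmorphD, rmorphN).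
have K_half : ~~ odd n ->
    K n./2 = (0 <= 1 + p - q - r) && (0 <= 1 - p + q - r).
  move=> n_even; have n2 : n = (n./2 * 2)%N by lia.
  have w_half : w ^+ n./2 = -1.
    have := wn1; rewrite {1}n2 exprM => /eqP.
    rewrite sqrf_eq1 -(prim_order_dvd w_prim) gtnNdvd /=; try lia.
    by move/eqP.
  rewrite /K w_half mulrN1 -rmorphB complex_ler_norml.
  by congr (_ && _); apply/idP/idP; lra.
have K_sym a : (a <= n)%N -> K (n - a)%N = K a.
  move=> a_le; rewrite /K (norm_prim_root_affine w_prim) //;
  by rewrite complex_real.
split=> [pos|[triv sgn half small] a].
  have /andP[-> ->] : (0 <= 1 + p + q + (2 * n - 3)%N%:R * r)
                       && (0 <= 1 - p - q + r).
    by rewrite -trivial_block; have := pos (Ordinal n_gt0).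
  have posK a : (0 < a < n)%N -> K a.
    move=> /andP[a_gt0 a_lt]; rewrite -block.
    by have := pos (Ordinal a_lt); rewrite /= gtn_eqF.
  split=> // [n_even|a a_bound]; last by apply: posK; lia.
  by apply/andP; rewrite -K_half //; apply: posK; lia.
have [a0|a_neq0] := eqVneq (a : nat) 0%N.
  by rewrite a0 /= trivial_block triv sgn.
rewrite /= block.
have [a_small|a_large] := leqP a ((n - 1) %/ 2).
  by apply: small; rewrite lt0n a_neq0.
have a_lt := ltn_ord a.
have [/andP[n_even /eqP ->]|] := boolP (~~ odd n && (a == n./2 :> nat)).
  by rewrite K_half //; apply/andP; apply: half.
move=> not_half; rewrite -K_sym ?(ltnW a_lt) //; apply: small; lia.
Qed.

Theorem proposition7p1 (R : realType) (n : nat) (n_ge2 : (2 <= n)%N)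
    (gT : finGroupType) (s t : gT) (hst : dihedral_coxeter_generators n s t)
    (p q r : R) :
  positive_definite (fun w : gT => (dihedral_function s t p q r w)%:C) <->
  [/\ 0 <= 1 + p + q + (2 * n - 3)%N%:R * r,
      0 <= 1 - p - q + r,
      ~~ odd n -> 0 <= 1 + p - q - r /\ 0 <= 1 - p + q - r
    & forall a : nat, (1 <= a <= (n - 1) %/ 2)%N ->
        `|(p - r)%:C + (q - r)%:C * cexpi (2 * pi * a%:R / n%:R)|
          <= (1 - r)%:C].
Proof.
have w_prim : n.-primitive_root (cexpi (2 * pi / n%:R) : R[i]).
  by apply: cexpi_primitive_root; lia.
have funE : (fun w : gT => (dihedral_function s t p q r w)%:C)
            =1 coxeter_function s t p%:C q%:C r%:C.
  move=> x; rewrite /dihedral_function /coxeter_function.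
  by do 3!case: ifP => //.
have hformE' f : hform (fun w : gT => (dihedral_function s t p q r w)%:C) f
                 = hform (coxeter_function s t p%:C q%:C r%:C) f.
  by apply: eq_bigr => x _; apply: eq_bigr => y _; rewrite funE.
have posE : positive_definite (fun w : gT => (dihedral_function s t p q r w)%:C)
    <-> (forall f, 0 <= hform (coxeter_function s t p%:C q%:C r%:C) f).
  rewrite positive_definiteE.
  by split=> pos f; [rewrite -hformE' | rewrite hformE'].
rewrite posE (hform_coxeter_function_ge0 n_ge2 hst w_prim);
  try by rewrite complex_real.
rewrite (dihedral_blocks _ _ _ n_ge2 w_prim).
have expE a : cexpi (2 * pi / n%:R) ^+ a = cexpi (2 * pi * a%:R / n%:R) :> R[i].
  by rewrite cexpiX mulrAC.
by split=> -[triv sgn half small]; split=> // a /small; rewrite expE.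
Qed.
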